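(* For every integer $k\geq 2$, the second largest element of $H(\infty,k)$ equals $2^k-2^{k-2}$ (the largest being $2^k$). Moreover, $2^k-2^{k-2}\in H(n,k)$ for all integers $n>k$.
   Context: Let $\mathbb{H}^n:=\{0,1\}^n\subset\mathbb{R}^n$. For integers $n\geq k\geq 1$, $H(n,k)$ denotes the set of non-zero cardinalities of intersections of $\mathbb{H}^n$ with $k$-dimensional affine subspaces of $\mathbb{R}^n$: $H(n,k)=\{t>0:\exists\, S\subset\mathbb{R}^n \text{ affine subspace},\ \dim S=k,\ t=|\mathbb{H}^n\cap S|\}$. Equivalently (by the symmetries of the hypercube), with $m=n-k$, $H(n,k)=\{t:\exists\, L:\mathbb{R}^k\to\mathbb{R}^m \text{ linear},\ t=|\mathbb{H}^k\cap L^{-1}(\mathbb{H}^m)|\}$. Finally, $H(\infty,k):=\bigcup_{n\geq k}H(n,k)$. *)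

(* Defs.v *)
From HB Require Import structures.
From mathcomp Require Import all_boot all_order all_algebra.
From mathcomp Require Import all_classical all_reals.

Set Implicit Arguments.
Unset Strict Implicit.
Unset Printing Implicit Defensive.

Import Order.TTheory GRing.Theory Num.Theory.

Local Open Scope classical_set_scope.
Local Open Scope ring_scope.

Definition hypercube (R : realType) (n : nat) : set 'rV[R]_n :=
  [set x | forall i, x ord0 i = 0 \/ x ord0 i = 1].

(* [S] is a translate [p + V] of a linear subspace [V] of dimension [k];
   in particular [S] is nonempty. *)
Definition affine_subspace (R : realType) (n k : nat) (S : set 'rV[R]_n) : Prop :=
  exists (p : 'rV[R]_n) (V : {vspace 'rV[R]_n}),
    \dim V = k /\ S = [set x | x - p \in V].

(* [A #= `I_t] says that [A] is finite with exactly [t] elements. *)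
Definition H (R : realType) (n k : nat) : set nat :=
  [set t | (0 < t)%N /\
     exists S : set 'rV[R]_n,
       affine_subspace k S /\ (@hypercube R n `&` S #= `I_t)%card].

Definition Hinf (R : realType) (k : nat) : set nat :=
  \bigcup_(n in [set n | (k <= n)%N]) H R n k.

Definition is_largest (A : set nat) (m : nat) : Prop :=
  A m /\ forall t, A t -> (t <= m)%N.

Definition is_second_largest (A : set nat) (s : nat) : Prop :=
  exists m, is_largest A m /\ is_largest (A `\ m) s.

(* Main.v *)
Require Import Defs.
From mathcomp Require Import all_boot all_order all_algebra.
From mathcomp Require Import all_classical all_reals.

(* An affine k-plane is a graph over k of the coordinates, so its hypercube
   points correspond to the vertices of {0,1}^k at which finitely many affine
   functionals all take values in {0,1}.  If fewer than 2^k vertices remain, one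
   of these functionals takes some value outside {0,1}.  Then there are two
   directions such that each of the 2^(k-2) squares spanned by them contains a
   vertex where it does: if two coefficients a, b are nonzero, then
   c, c + a, c + b, c + a + b cannot all lie in {0,1}; otherwise the functional
   depends on at most one coordinate, and that coordinate is chosen as one of
   the directions.  The bound is attained by the functional x_0 + x_1. *)

Import Order.TTheory GRing.Theory Num.Theory.
Local Open Scope ring_scope.

(** * Counting families of subsets *)

Section SubsetCounting.
Variable T : finType.

Lemma card_powersetC (D : {set T}) :
  #|powerset (~: D)%SET| = (2 ^ (#|T| - #|D|))%N.
Proof. by rewrite card_powerset cardsCs finset.setCK. Qed.

Lemma card_supersets (D : {set T}) :
  #|[set s : {set T} | D \subset s]%SET| = (2 ^ (#|T| - #|D|))%N.
Proof.
rewrite -card_powersetC -[RHS](card_imset _ (@finset.setC_inj T)).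
apply: eq_card => s; rewrite inE; apply/idP/imsetP => [Ds|[u]].
  by exists (~: s)%SET; rewrite ?finset.setCK// powersetE finset.setCS.
by rewrite powersetE => uD ->; rewrite finset.subsetC.
Qed.

(** The cubes of all [s :|: u] with [u] inside [D], one for each [s] disjoint from [D], partition
    the subsets of [T]. Removing [D] sends a member of [B] to the index of its cube, and by
    hypothesis every index is reached. *)
Lemma leq_card_meet_cubes (D : {set T}) (B : {set {set T}}) :
  (forall s : {set T}, [disjoint s & D] ->
     exists2 u : {set T}, u \subset D & (s :|: u)%SET \in B) ->
  (2 ^ (#|T| - #|D|) <= #|B|)%N.
Proof.
move=> meetB; rewrite -card_powersetC.
apply: leq_trans (leq_imset_card (fun t : {set T} => t :\: D)%SET B).
apply: subset_leq_card; apply/fintype.subsetP => s.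
rewrite powersetE => sD.
have dsD : [disjoint s & D] by rewrite finset.disjoints_subset.
have [u uD sB] := meetB s dsD.
apply/imsetP; exists (s :|: u)%SET => //.
rewrite finset.setDUl (_ : (u :\: D)%SET = finset.set0) ?finset.setU0.
  by apply/esym/finset.setDidPl.
by apply/eqP; rewrite finset.setD_eq0.
Qed.

End SubsetCounting.

(** * Values of one affine functional on the vertices of a cube *)

Definition is01 {R : numDomainType} (x : R) := (x == 0) || (x == 1).

(** If [c] is 0, the first three values force [a] and [b] to be 1 and the fourth value is 2; if [c]
    is 1, they force both to be -1 and the fourth value is -1. *)
Lemma is01_square {R : numDomainType} (c a b : R) : a != 0 -> b != 0 ->
  is01 c -> is01 (c + a) -> is01 (c + b) -> ~~ is01 (c + (a + b)).
Proof.
rewrite /is01 => a0 b0 /orP[]/eqP->.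
  rewrite !add0r (negPf a0) (negPf b0) /= => /eqP -> /eqP ->.
  by rewrite -mulr2n pnatr_eq0 pnatr_eq1.
have E (x : R) : x != 0 -> (1 + x == 0) || (1 + x == 1) -> x = -1.
  move=> x0 /orP[]; first by rewrite addrC addr_eq0 => /eqP.
  by rewrite -[X in _ == X]addr0 (inj_eq (addrI _)) (negPf x0).
move=> /E -> // /E -> //; rewrite addrA subrr add0r oppr_eq0 oner_eq0 /=.
by rewrite eq_sym -subr_eq0 opprK -mulr2n pnatr_eq0.
Qed.

Lemma card_affine_not01 {R : numDomainType} {T : finType} (c : R) (a : T -> R)
    (s0 : {set T}) :
  (1 < #|T|)%N -> ~~ is01 (c + \sum_(i in s0) a i) ->
  (2 ^ (#|T| - 2) <=
     #|[set s : {set T} | ~~ is01 (c + \sum_(i in s) a i)]%SET|)%N.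
Proof.
move=> T2 s0P.
have other (i : T) : exists j, i != j.
  have := T2; rewrite (cardD1 i) inE add1n ltnS => /card_gt0P[j].
  by rewrite !inE andbT => ji; exists j; rewrite eq_sym.
suff [i [j [ij sqP]]] : exists i j, i != j /\
    forall s : {set T}, [disjoint s & [set i; j]%SET] ->
     exists2 u : {set T}, u \subset [set i; j]%SET &
       ~~ is01 (c + (\sum_(l in s) a l + \sum_(l in u) a l)).
  apply: leq_trans (leq_card_meet_cubes _ [set i; j]%SET _ _).
    by rewrite cards2 ij.
  move=> s sD; have [u uD uP] := sqP s sD.
  exists u => //; rewrite inE (eq_bigl _ _ (fun i => finset.in_setU i s u)) bigU //=.
  by rewrite disjoint_sym; apply: disjointWl uD _; rewrite disjoint_sym.
case: (boolP [exists i, exists j, [&& i != j, a i != 0 & a j != 0]]).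
  move=> /existsP[i /existsP[j /and3P[ij ai aj]]]; exists i, j; split=> // s _.
  set A := \sum_(l in s) a l.
  have [A0|] := boolP (is01 (c + A)); last first.
    by move=> ?; exists finset.set0; rewrite ?finset.sub0set // big_set0 addr0.
  have [Ai|] := boolP (is01 (c + A + a i)); last first.
    rewrite -addrA => ?; exists [set i]%SET; last by rewrite big_set1.
    by rewrite finset.sub1set !inE eqxx.
  have [Aj|] := boolP (is01 (c + A + a j)); last first.
    rewrite -addrA => ?; exists [set j]%SET; last by rewrite big_set1.
    by rewrite finset.sub1set !inE eqxx orbT.
  exists [set i; j]%SET => //.
  by rewrite big_setU1 ?inE //= big_set1 addrA is01_square.
rewrite negb_exists => /forallP a0.
(* If all coefficients vanish, any [i] will do. *)
have [i ai] : exists i, forall j, j != i -> a j = 0.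
  have [/existsP[i ai]|] := boolP [exists i, a i != 0].
    exists i => j ji; have := a0 i; rewrite negb_exists => /forallP/(_ j).
    by rewrite eq_sym ji ai /= negbK => /eqP.
  rewrite negb_exists => /forallP az.
  have /card_gt0P[i _] : (0 < #|T|)%N by apply: leq_trans T2.
  by exists i => j _; apply/eqP; rewrite -[_ == _]negbK az.
have sumE (s : {set T}) : \sum_(l in s) a l = if i \in s then a i else 0.
  case: ifP => si.
    by rewrite (bigD1 i) //= big1 ?addr0 // => l /andP[_ /ai].
  by apply: big1 => l ls; apply: ai; apply: contraFN si => /eqP <-.
(* The functional ignores [j], which only serves to make the cubes squares. *)
have [j ij] := other i; exists i, j; split=> // s.
rewrite disjoint_sym => /pred0P/(_ i) /=; rewrite !inE eqxx /= => si.
(* As [i] is not in [s], adding this set makes the vertex agree with [s0] at [i], so the functional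
   takes its bad value at [s0] again. *)
exists (s0 :&: [set i])%SET.
  apply: fintype.subset_trans (finset.subsetIr _ _) _.
  by rewrite finset.sub1set !inE eqxx.
by move: s0P; rewrite !sumE si !inE eqxx andbT add0r.
Qed.

(** * Affine planes as graphs over k of the coordinates *)

Section Graph.
Context {R : realType} {k n : nat}.
Implicit Types (f : 'I_k -> 'I_n) (q : 'rV[R]_n) (M : 'M[R]_(k, n)).

Definition plane q M : set 'rV[R]_n := range (fun y : 'rV_k => q + y *m M).

(* [plane q M] is the graph of an affine map over the coordinates [f]. *)
Definition is_graph f q M :=
  (forall i, q ord0 (f i) = 0) /\ (forall l i, M l (f i) = (l == i)%:R).

(** A set [s] stands for the vertex of the k-cube with ones exactly on [s]; the sum is the j-th
    coordinate of the point of the plane above it. *)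
Definition good q M : {set {set 'I_k}} :=
  [set s : {set 'I_k} | [forall j, is01 (q ord0 j + \sum_(i in s) M i j)]]%SET.

Definition vertex q M (s : {set 'I_k}) : 'rV[R]_n :=
  q + (\row_i (i \in s)%:R) *m M.

Lemma vertexE q M s j : vertex q M s ord0 j = q ord0 j + \sum_(i in s) M i j.
Proof.
rewrite !mxE [in RHS]big_mkcond; congr (_ + _); apply: eq_bigr => i _.
by rewrite !mxE; case: ifP => _; rewrite ?mul1r ?mul0r.
Qed.

Lemma graph_coord f q M (y : 'rV_k) i :
  is_graph f q M -> (q + y *m M) ord0 (f i) = y ord0 i.
Proof.
move=> [q0 MI]; rewrite !mxE q0 add0r (bigD1 i) //= MI eqxx mulr1 big1 ?addr0//.
by move=> l li; rewrite MI (negPf li) mulr0.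
Qed.

Lemma card_finset_eq (T : finType) (A : {set T}) :
  ([set x | x \in A]%classic #= `I_#|A|)%card.
Proof.
have -> : [set x | x \in A]%classic = [set enum_val i | i in [set: 'I_#|A|]]%classic.
  rewrite eqEsubset; split=> x /=.
    by move=> xA; exists (enum_rank_in xA x) => //; rewrite enum_rankK_in.
  by move=> [i _ <-]; exact: enum_valP.
apply: card_eq_trans (inj_card_eq _) _; first by move=> x y _ _; exact: enum_val_inj.
by apply: card_esym; exact: card_II.
Qed.

(** [vertex] is a bijection from the good sets to the hypercube points of the plane: the coordinates
    [f] of a point recover its parameter, which is a 0/1 vector when the point lies in the
    hypercube. *)
Lemma card_hypercube_plane f q M : is_graph f q M ->
  (@hypercube R n `&` plane q M #= `I_#|good q M|)%card.
Proof.
move=> G.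
have -> : (@hypercube R n `&` plane q M)%classic =
    [set vertex q M s | s in [set s | s \in good q M]]%classic.
  rewrite eqEsubset; split=> x /=.
    move=> [x01 [y _ xE]]; pose s := [set i | y ord0 i == 1]%SET.
    have xs : vertex q M s = x.
      rewrite -xE; congr (_ + _ *m _); apply/rowP => i; rewrite !mxE inE.
      have := x01 (f i); rewrite -xE (graph_coord _ _ _ _ _ G).
      by case=> ->; rewrite ?eqxx // eq_sym oner_eq0.
    exists s => //; rewrite inE; apply/forallP => j; rewrite -vertexE xs.
    by rewrite /is01; case: (x01 j) => ->; rewrite eqxx ?orbT.
  move=> [s]; rewrite inE => /forallP sP <-; split; last by eexists.
  by move=> j; have := sP j; rewrite -vertexE => /orP[]/eqP; [left|right].
apply: card_eq_trans (inj_card_eq _) (card_finset_eq _ _) => s t _ _ E.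
apply/setP => i; have := graph_coord f q M (\row_i (i \in s)%:R) i G.
rewrite -/(vertex q M s) E (graph_coord _ _ _ _ _ G) !mxE => /eqP.
by rewrite eqr_nat; do 2!case: (_ \in _).
Qed.

(** A basis of the direction space forms a matrix [B] of rank k, so k of its columns form an
    invertible block [C]. Multiplying by the inverse of [C] turns this block into the identity, and
    sliding [p] along the plane makes its coordinates [f] vanish. *)
Lemma affine_subspace_graph (S : set 'rV[R]_n) :
  affine_subspace k S -> exists f q M, is_graph f q M /\ S = plane q M.
Proof.
move=> [p [V [dimV ->]]].
have [B freeB VB] : exists2 B : 'M[R]_(k, n), row_free B &
    forall x, x \in V <-> exists u : 'rV_k, x = u *m B.
  case: k / dimV; pose B := \matrix_(i < \dim V) (vbasis V)`_i.
  have mulB (u : 'rV_(\dim V)) : u *m B = \sum_i u ord0 i *: (vbasis V)`_i.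
    by rewrite mulmx_sum_row; apply: eq_bigr => i _; rewrite rowK.
  exists B.
    apply: inj_row_free => v; rewrite mulB => v0.
    apply/rowP => i; rewrite mxE.
    exact: (freeP (X := vbasis V) (basis_free (vbasisP V)) (v ord0)) v0 i.
  move=> x; split=> [xV|[u ->]].
    exists (\row_i coord (vbasis V) i x); rewrite mulB {1}(coord_vbasis xV).
    by apply: eq_bigr => i _; rewrite mxE.
  rewrite mulB; apply: memv_suml => i _; apply: memvZ; apply: vbasis_mem.
  by rewrite mem_nth // size_tuple.
have fullB : row_full B^T by rewrite /row_full mxrank_tr; exact: freeB.
pose f := fullrankfun fullB; pose C := colsub f B.
have uC : C \in unitmx.
  have <- : (rowsub f B^T)^T = C by apply/matrixP => i j; rewrite !mxE.
  by rewrite unitmx_tr; exact: fullrowsub_unit.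
pose M := invmx C *m B; pose q := p - (colsub f p) *m M.
have MI : colsub f M = 1%:M by rewrite -(mulVmx uC) mulmx_colsub.
exists f, q, M; split.
  split=> [i|l i].
    have -> : q ord0 (f i) = colsub f q ord0 i by rewrite [RHS]mxE.
    have -> : colsub f q = colsub f p - colsub f p *m colsub f M.
      by rewrite mulmx_colsub; apply/matrixP => a b; rewrite !mxE.
    by rewrite MI mulmx1 subrr mxE.
  by have := congr1 (fun A : 'M_k => A l i) MI; rewrite !mxE.
rewrite eqEsubset; split=> x /=.
  (* The parameter of a point of a graph is its tuple of coordinates [f], computed here for
     [p + u *m B]. *)
  move=> /VB[u xu]; exists (u *m C + colsub f p) => //.
  have CM : u *m C *m M = u *m B by rewrite /M mulmxA mulmxK.
  by rewrite mulmxDl CM -xu addrACA addNr addr0 addrC subrK.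
move=> [y _ <-]; apply/VB; exists ((y - colsub f p) *m invmx C).
by rewrite -mulmxA -/M mulmxBl /q addrAC [p - _]addrC addrK addrC.
Qed.

Lemma graph_affine_subspace f q M :
  is_graph f q M -> affine_subspace k (plane q M).
Proof.
move=> [_ MI]; pose F := linfun (mulmxr M : 'rV_k -> 'rV_n).
exists q, (limg F); split.
  (* The coordinates [f] of [y *m M] give back [y], so [F] is injective. *)
  have kerF : lker F = 0%VS.
    apply/eqP/lker0P => u v; rewrite !lfunE /= => uv.
    apply/rowP => i; rewrite -(graph_coord f 0 M u i) ?uv ?graph_coord //;
      by split=> // j; rewrite mxE.
  have := limg_ker_dim F fullv; rewrite kerF capv0 dimv0 add0n => ->.
  by rewrite dimvf dim_matrix mul1r.
rewrite eqEsubset; split=> x /=.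
  move=> [y _ <-]; rewrite addrC addKr; apply/memv_imgP; exists y => //.
    by rewrite memvf.
  by rewrite lfunE.
move=> /memv_imgP[y _ E]; exists y => //.
by move: E; rewrite lfunE /= => <-; rewrite addrC subrK.
Qed.

End Graph.

(** * The elements of H(n,k): the gap below the maximum and the two extremal values *)

Lemma H_goodP (R : realType) (n k t : nat) :
  H R n k t <-> (0 < t)%N /\ exists f (q : 'rV[R]_n) (M : 'M[R]_(k, n)),
    is_graph f q M /\ t = #|good q M|.
Proof.
split=> [[t0 [S [/affine_subspace_graph[f [q [M [G ->]]]] St]]]|].
  split=> //; exists f, q, M; split=> //; apply/card_eq_II.
  by apply: card_eq_trans (card_hypercube_plane _ _ _ G); rewrite card_eq_sym.
move=> [t0 [f [q [M [G tE]]]]]; split=> //; exists (plane q M).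
by split; [exact: graph_affine_subspace G | rewrite tE; exact: card_hypercube_plane G].
Qed.

Lemma H_gap (R : realType) (n k t : nat) : (2 <= k)%N -> H R n k t ->
  t = (2 ^ k)%N \/ (t <= 2 ^ k - 2 ^ (k - 2))%N.
Proof.
move=> k2 /H_goodP[_ [f [q [M [_ ->]]]]].
have cardT : #|{: {set 'I_k}}| = (2 ^ k)%N.
  by rewrite -cardsT -powersetT card_powerset cardsT card_ord.
have [/forallP allgood|] := boolP [forall s, s \in good q M].
  by left; rewrite -cardT; apply: eq_card => s; rewrite allgood.
rewrite negb_forall => /existsP[s0]; rewrite inE negb_forall => /existsP[j s0j].
right; rewrite -cardT -(cardC (mem (good q M))).
suff bad : (2 ^ (k - 2) <= #|[predC mem (good q M)]|)%N.
  by rewrite -addnBA // leq_addr.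
have k2' : (1 < #|'I_k|)%N by rewrite card_ord.
have := card_affine_not01 _ (fun i => M i j) s0 k2' s0j; rewrite card_ord.
move=> /leq_trans; apply; apply: subset_leq_card; apply/fintype.subsetP => s.
by rewrite !inE negb_forall => ?; apply/existsP; exists j.
Qed.

Lemma H_full (R : realType) (k : nat) : H R k k (2 ^ k)%N.
Proof.
apply/H_goodP; split; first by rewrite expn_gt0.
exists id, 0, 1%:M; split; first by split=> *; rewrite mxE.
rewrite -[k in LHS]card_ord -cardsT -card_powerset powersetT cardsT.
apply: eq_card => s; rewrite !inE; apply/esym/forallP => j.
rewrite mxE add0r big_mkcond (bigD1 j) //= big1 ?addr0 => [|i ij].
  by rewrite mxE eqxx /is01; case: ifP; rewrite eqxx ?orbT.
by rewrite mxE (negPf ij) if_same.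
Qed.

Lemma H_attained (R : realType) (n k : nat) : (2 <= k)%N -> (k < n)%N ->
  H R n k (2 ^ k - 2 ^ (k - 2))%N.
Proof.
move=> k2 kn; apply/H_goodP; split.
  by rewrite subn_gt0 ltn_exp2l // ltn_subrL (ltnW k2).
pose i0 : 'I_k := Ordinal (ltnW k2); pose i1 : 'I_k := Ordinal k2.
pose D := [set i0; i1]%SET.
(* The first k columns are the coordinate functions, column k, available since [k < n], is x_0 +
   x_1, and all later columns are zero. *)
pose M : 'M[R]_(k, n) := \matrix_(l, j)
  if (j < k)%N then (l == j :> nat)%:R else ((j == k :> nat) && (l \in D))%:R.
exists (widen_ord (ltnW kn)), 0, M; split.
  by split=> [i|l i]; rewrite !mxE //= ltn_ord.
have cardT : #|{: {set 'I_k}}| = (2 ^ k)%N.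
  by rewrite -cardsT -powersetT card_powerset cardsT card_ord.
(* The bad vertices are those containing both [i0] and [i1], where column k takes the value 2. *)
have <- : #|[set s : {set 'I_k} | D \subset s]%SET| = (2 ^ (k - 2))%N.
  by rewrite card_supersets card_ord cards2.
rewrite -cardT -cardsT -cardsDS ?subsetT //; apply: eq_card => s; rewrite !inE andbT.
have sumD : \sum_(i in s) (i \in D)%:R = (i0 \in s)%:R + (i1 \in s)%:R :> R.
  rewrite big_mkcond /= (bigD1 i0) //= (bigD1 i1) //= big1 ?addr0.
    by rewrite !inE !eqxx orbT; do 2!case: (_ \in s).
  by move=> i /andP[n0 n1]; rewrite !inE (negPf n0) (negPf n1) if_same.
have -> : (D \subset s) = (i0 \in s) && (i1 \in s).
  by rewrite finset.subUset !finset.sub1set.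
apply/idP/forallP => [Ds j|/(_ (Ordinal kn))]; last first.
  rewrite mxE add0r; under eq_bigr do rewrite mxE /= ltnn eqxx /=.
  rewrite sumD /is01 -natrD pnatr_eq0 pnatr_eq1.
  by case: (i0 \in s); case: (i1 \in s).
rewrite mxE add0r; have [jk|kj] := ltnP j k.
  rewrite big_mkcond (bigD1 (Ordinal jk)) //= big1 ?addr0 => [|i ij].
    by rewrite mxE jk eqxx /is01; case: ifP; rewrite eqxx ?orbT.
  by rewrite mxE jk; move: ij; rewrite -val_eqE /= => /negPf ->; rewrite if_same.
have [jk|jk] := eqVneq (j : nat) k.
  under eq_bigr do rewrite mxE jk ltnn eqxx /=.
  rewrite sumD /is01 -natrD pnatr_eq0 pnatr_eq1.
  by move: Ds; case: (i0 \in s); case: (i1 \in s).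
rewrite big1 => [|i _]; first by rewrite /is01 eqxx.
by rewrite mxE ltnNge kj (negPf jk).
Qed.

Local Close Scope ring_scope.

Theorem theorem3p1 (R : realType) (k : nat) (hk : 2 <= k) :
  [/\ is_largest (Hinf R k) (2 ^ k),
      is_second_largest (Hinf R k) (2 ^ k - 2 ^ (k - 2)) &
      forall n : nat, k < n -> H R n k (2 ^ k - 2 ^ (k - 2))].
Proof.
have le_pow n t : H R n k t -> t <= 2 ^ k.
  by move=> /(H_gap _ _ _ _ hk)[->//|] /leq_trans; apply; exact: leq_subr.
have largest : is_largest (Hinf R k) (2 ^ k).
  split; first by exists k => //=; exact: H_full.
  by move=> t [n _ /le_pow].
split=> //; last by move=> n; exact: H_attained.
exists (2 ^ k); split=> //; split.
  (* The dimension k + 1 is the smallest to which [H_attained] applies. *)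
  split; first by exists k.+1; [exact: leqnSn | exact: H_attained].
  (* The value differs from [2 ^ k] because their difference [2 ^ (k - 2)] is positive. *)
  by apply/eqP; rewrite neq_ltn -subn_gt0 subKn ?expn_gt0 // leq_exp2l ?leq_subr.
by move=> t [[n _ /(H_gap _ _ _ _ hk)[-> /(_ erefl)|]]].
Qed.
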